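(* Let $P_n$ denote either $P^{\rm Ab}_n$ (for all $n$) or $P^{\rm aB}_n$ (for all $n$). For each $0<\varepsilon\leq\tfrac12$ there exists a constant $C<\infty$ such that $$P_n^{-1}(1-\varepsilon)-P_n^{-1}(\varepsilon)\leq \frac{C}{n}\qquad\text{for all } n\geq1.$$
   Context: Fix $n\geq1$. Alice and Bob alternately make moves, Alice first, each making $n$ moves from $\{1,2\}$; let $a_1,\dots,a_n$ be Alice's and $b_1,\dots,b_n$ Bob's moves. - In ${\rm Ab}_n(p)$ the outcome is $((a_1,\dots,a_n),\#\{k:b_k=1\})$. - In ${\rm aB}_n(p)$ it is $(\#\{k:a_k=1\},(b_1,\dots,b_n))$. To each possible outcome a winner is assigned independently: Bob with probability $p$, Alice with probability $1-p$. The players know the assignment and all previous moves. $P^{\rm Ab}_n(p)$ and $P^{\rm aB}_n(p)$ are the probabilities that Bob has a winning strategy (a rule choosing his moves from the previous moves guaranteeing a win whatever Alice plays). Each $P_n$ is a continuous, strictly increasing function from $[0,1]$ onto $[0,1]$, and $P_n^{-1}$ denotes its inverse. *)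

(* Defs.v *)
From mathcomp Require Import all_boot all_order all_algebra.
From mathcomp Require Import boolp reals.
Set Implicit Arguments. Unset Strict Implicit. Unset Printing Implicit Defensive.
Import Order.TTheory GRing.Theory Num.Theory.
Local Open Scope ring_scope.

(* Moves are encoded as booleans: true = move 1, false = move 2. *)

Inductive game := Ab | aB.

(* Outcome space: a sequence of n moves together with a count in {0..n}.
   For Ab_n the outcome is ((a_1..a_n), #{k : b_k = 1});
   for aB_n it is (#{k : a_k = 1}, (b_1..b_n)), stored with its two
   components swapped (a harmless relabelling of the outcome set). *)
Definition outcome_t (n : nat) := ({ffun 'I_n -> bool} * 'I_n.+1)%type.

Definition count1 (n : nat) (x : {ffun 'I_n -> bool}) : 'I_n.+1 :=
  inord #|[set k | x k]|.

Definition outcome (g : game) (n : nat) (a b : {ffun 'I_n -> bool}) : outcome_t n :=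
  match g with
  | Ab => (a, count1 b)
  | aB => (b, count1 a)
  end.

(* A strategy for Bob: a rule choosing his next move from the full list of
   previous moves (a_1, b_1, ..., a_k), in chronological order. *)
Definition strategy := seq bool -> bool.

Fixpoint play (s : strategy) (as_ : seq bool) (hist : seq bool) : seq bool :=
  match as_ with
  | [::] => hist
  | a :: as' => let h := rcons hist a in play s as' (rcons h (s h))
  end.

Definition bob_moves (n : nat) (s : strategy) (a : {ffun 'I_n -> bool})
  : {ffun 'I_n -> bool} :=
  [ffun i : 'I_n => nth false (play s [seq a j | j <- enum 'I_n] [::]) (i.*2.+1)].

(* Winner assignment w : w o = true iff Bob wins outcome o.  Bob has a
   winning strategy iff some strategy wins against every play of Alice. *)
Definition bob_wins (g : game) (n : nat) (w : {ffun outcome_t n -> bool}) : Prop :=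
  exists s : strategy, forall a : {ffun 'I_n -> bool}, w (@outcome g n a (@bob_moves n s a)).

Definition Pn (R : realType) (g : game) (n : nat) (p : R) : R :=
  \sum_(w : {ffun outcome_t n -> bool} | `[< @bob_wins g n w >])
     \prod_(o : outcome_t n) (if w o then p else 1 - p).

(* Main.v *)
(* Flipping moves of the player whose moves are recorded completely permutes
   the outcomes with orbits of size 2 ^ n and preserves the event that Bob wins.
   Hence the influence of every single outcome is at most 2 ^- n I, where
   I = P_n' is the total influence (Margulis-Russo). By the Kahn-Kalai-Linial
   argument (Fourier-Walsh expansion for the p-biased measure and
   hypercontractivity) an event with such small influences has
   I >= c n P_n (1 - P_n), with c independent of p in (0, 1). On the interval
   where eps <= P_n <= 1 - eps the slope of P_n is then at least of order
   eps n, and the mean value theorem concludes. *)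
Require Import Defs.
From mathcomp Require Import all_boot all_order all_algebra.
From mathcomp Require Import boolp reals.
From mathcomp Require Import polyrcf.
From mathcomp Require Import ring lra zify.
Import Order.TTheory GRing.Theory Num.Theory.
Local Open Scope ring_scope.

(** * Fourier-Walsh analysis on the p-biased cube *)

Section Cube.
Context {A : comNzRingType}.
Implicit Types (p : A) (F G : seq bool -> A).

(** Integral over [n] independent bits, each true with probability [p]. The ring is arbitrary so
    that [p] may also be the indeterminate ['X]. *)
Fixpoint expect p n F : A :=
  if n is m.+1 then
    p * expect p m (fun x => F (true :: x)) + (1 - p) * expect p m (fun x => F (false :: x))
  else F [::].

(** Fourier-Walsh step in one coordinate: [F (b :: x) = avg p F x + (b - p) * jump F x], where
    [b - p] has mean 0 and variance [p * (1 - p)]. *)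
Definition avg p F x := p * F (true :: x) + (1 - p) * F (false :: x).

Definition jump F x := F (true :: x) - F (false :: x).

Definition diff i F x := F (set_nth false x i true) - F (set_nth false x i false).

(* The noise operator multiplies the Fourier-Walsh coefficient of a set S of
   coordinates by (p (1 - p)) ^ #|S|. *)
Fixpoint noise p n F (x : seq bool) : A :=
  if n is m.+1 then
    if x is b :: x' then
      noise p m (avg p F) x' +
      p * (1 - p) * (b%:R - p) * noise p m (jump F) x'
    else 0
  else F [::].

(* The coefficient of 'X^k is the sum of the squares of the Fourier-Walsh
   coefficients of F over the sets of k coordinates. *)
Fixpoint spectrum p n F : {poly A} :=
  if n is m.+1 then
    spectrum p m (avg p F) + (p * (1 - p)) *: 'X * spectrum p m (jump F)
  else (F [::] ^+ 2)%:P.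

Lemma eq_expect p n F G : F =1 G -> expect p n F = expect p n G.
Proof. by move=> /funext ->. Qed.

Lemma expectD p n F G : expect p n (fun x => F x + G x) = expect p n F + expect p n G.
Proof. by elim: n F G => //= n IH F G; rewrite !IH; ring. Qed.

Lemma expectZ p n c F : expect p n (fun x => c * F x) = c * expect p n F.
Proof. by elim: n F => //= n IH F; rewrite !IH; ring. Qed.

Lemma expect0 p n : expect p n (fun=> 0) = 0.
Proof. by elim: n => //= n ->; ring. Qed.

Lemma expect_avg p n F : expect p n (avg p F) = expect p n.+1 F.
Proof. by rewrite /= expectD !expectZ. Qed.

Lemma expectB p n F G : expect p n (fun x => F x - G x) = expect p n F - expect p n G.
Proof. by elim: n F G => //= n IH F G; rewrite !IH; ring. Qed.

Lemma avg_diff p i F : avg p (diff i.+1 F) = diff i (avg p F).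
Proof. by apply/funext => x; rewrite /avg /diff /=; ring. Qed.

Lemma jump_diff i F : jump (diff i.+1 F) = diff i (jump F).
Proof. by apply/funext => x; rewrite /jump /diff /=; ring. Qed.

Lemma avg_diff0 p F : avg p (diff 0 F) = jump F.
Proof. by apply/funext => -[|b x]; rewrite /avg /diff /jump /=; ring. Qed.

Lemma jump_diff0 F : jump (diff 0 F) = fun=> 0.
Proof. by apply/funext => -[|b x]; rewrite /diff /jump /=; ring. Qed.

Lemma spectrum0 p n : spectrum p n (fun=> 0) = 0.
Proof.
elim: n => /= [|n IH]; first by rewrite expr0n.
have -> : avg p (fun=> 0) = fun=> 0 by apply/funext => x; rewrite /avg; ring.
have -> : jump (fun=> 0) = fun=> 0 by apply/funext => x; rewrite /jump; ring.
by rewrite IH mulr0 addr0.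
Qed.

Lemma coef0_spectrum p n F : (spectrum p n F)`_0 = expect p n F ^+ 2.
Proof.
elim: n F => /= [F|n IH F]; first by rewrite coefC.
by rewrite coefD -scalerAl coefZ coefXM mulr0 addr0 IH expect_avg.
Qed.

(** Parseval: the cross terms vanish because [b - p] has mean 0. *)
Lemma spectrum1 p n F : (spectrum p n F).[1] = expect p n (fun x => F x ^+ 2).
Proof.
elim: n F => /= [F|n IH F]; first by rewrite hornerC.
rewrite !hornerE !IH -!expectZ -!expectD.
by apply: eq_expect => x; rewrite /avg /jump; ring.
Qed.

(** Differentiation counts a set S once for each [i] in S, and [diff i] moves the squared
    coefficient of S to S without [i], divided by [p * (1 - p)]. *)
Lemma deriv_spectrum p n F :
  (spectrum p n F)^`() = (p * (1 - p)) *: \sum_(i < n) spectrum p n (diff i F).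
Proof.
elim: n F => [|n IH] F; first by rewrite derivC big_ord0 scaler0.
rewrite big_ord_recl [spectrum p n.+1 F]/= [spectrum p n.+1 (diff _ _)]/=.
rewrite avg_diff0 jump_diff0 spectrum0.
under eq_bigr => i _ do rewrite /= /bump /= add1n avg_diff jump_diff.
rewrite big_split /= -mulr_sumr derivD derivM !IH derivZ derivX.
rewrite -!mul_polyC; move: (p * (1 - p))%:P => c; ring.
Qed.

Lemma expect_mul_noise p n F :
  expect p n (fun x => F x * noise p n F x) = (spectrum p n F).[p * (1 - p)].
Proof.
elim: n F => /= [F|n IH F]; first by rewrite hornerC.
rewrite hornerD hornerM hornerZ hornerX -!IH -!expectZ -!expectD.
apply: eq_expect => x; move: (noise p n (avg p F) x) (noise p n (jump F) x) => u v.
by rewrite /avg /jump; ring.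
Qed.

End Cube.

(** * The Margulis-Russo formula *)

Section CubePoly.
Context {A : comNzRingType}.
Implicit Types (p : A) (F : seq bool -> A).

Lemma horner_expectX p n F :
  (expect 'X n (fun x => (F x)%:P)).[p] = expect p n F.
Proof. by elim: n F => /= [F|n IH F]; rewrite !hornerE ?IH. Qed.

(** By the product rule, differentiating the weights of the first coordinate yields the term of
    [diff 0]; the other coordinates follow by induction. *)
Lemma deriv_expectX n F :
  (expect 'X n (fun x => (F x)%:P))^`() =
  \sum_(i < n) expect 'X n (fun x => (diff i F x)%:P).
Proof.
elim: n F => [F|n IH F]; first by rewrite derivC big_ord0.
rewrite big_ord_recl.
have -> : expect 'X n.+1 (fun x => (diff 0 F x)%:P) =
    expect 'X n (fun x => (F (true :: x))%:P) - expect 'X n (fun x => (F (false :: x))%:P).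
  rewrite -expectB -expect_avg; apply: eq_expect => x.
  by rewrite /avg /diff /= polyCB; ring.
rewrite /= big_split /= -!mulr_sumr derivD !derivM derivB derivX derivC !IH.
by rewrite /diff /=; ring.
Qed.

End CubePoly.

(** * Hypercontractivity for the p-biased measure *)

Section Hypercontractivity.
Context {R : realFieldType}.
Variable p : R.
Hypothesis p01 : 0 <= p <= 1.
Implicit Types F G : seq bool -> R.
Local Notation s := (p * (1 - p)).

Let s_ge0 : 0 <= s.
Proof. by case/andP: p01 => *; nra. Qed.

Let s_le4 : s <= 4^-1.
Proof. by have := sqr_ge0 (p - 2^-1); lra. Qed.

Lemma expect_le n F G : (forall x, F x <= G x) -> expect p n F <= expect p n G.
Proof.
case/andP: p01 => p0 p1; elim: n F G => //= n IH F G FG.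
by apply: lerD; apply: ler_wpM2l; rewrite ?subr_ge0 //; apply: IH.
Qed.

Lemma expect_ge0 n F : (forall x, 0 <= F x) -> 0 <= expect p n F.
Proof. by move=> F0; rewrite -(expect0 p n); apply: expect_le. Qed.

Lemma coef_spectrum_ge0 n F k : 0 <= (spectrum p n F)`_k.
Proof.
elim: n F k => [|n IH] F k /=.
  by rewrite coefC; case: ifP => // _; apply: sqr_ge0.
rewrite coefD addr_ge0 // -scalerAl coefZ coefXM mulr_ge0 //.
by case: ifP.
Qed.

Lemma horner_spectrum_ge0 n F x : 0 <= x -> 0 <= (spectrum p n F).[x].
Proof.
move=> x0; rewrite horner_coef; apply: sumr_ge0 => i _.
by rewrite mulr_ge0 ?exprn_ge0 ?coef_spectrum_ge0.
Qed.

Lemma expect_CauchySchwarz n F G :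
  expect p n (fun x => F x * G x) ^+ 2 <=
  expect p n (fun x => F x ^+ 2) * expect p n (fun x => G x ^+ 2).
Proof.
set a := expect p n (fun x => F x ^+ 2); set b := expect p n (fun x => F x * G x).
set c := expect p n (fun x => G x ^+ 2).
have quad t : 0 <= a - 2 * t * b + t ^+ 2 * c.
  have -> : a - 2 * t * b + t ^+ 2 * c = expect p n (fun x => (F x - t * G x) ^+ 2).
    by rewrite -!expectZ -expectB -expectD; apply: eq_expect => x; ring.
  by apply: expect_ge0 => x; apply: sqr_ge0.
have c0 : 0 <= c by apply: expect_ge0 => x; apply: sqr_ge0.
have [cz|cn] := eqVneq c 0.
  have [->|bn] := eqVneq b 0; first by rewrite cz expr0n mulr0.
  (* With [c = 0] the quadratic is affine in [t]; at this [t] it would equal -1. *)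
  have := quad ((a + 1) / (2 * b)); rewrite cz mulr0 addr0.
  have -> : 2 * ((a + 1) / (2 * b)) * b = a + 1 by field.
  by lra.
have cp : 0 < c by rewrite lt0r cn.
(* The minimizer of the quadratic. *)
have := quad (b / c).
have -> : a - 2 * (b / c) * b + (b / c) ^+ 2 * c = (a * c - b ^+ 2) / c by field.
by rewrite pmulr_lge0 ?invr_gt0 // subr_ge0.
Qed.

(** The right side is the fourth power of the 2-norm of [F] after noise of rate [sqrt s], so noise
    of rate [sqrt s] is bounded from L2 to L4 with norm 1. Induction on the first coordinate:
    Cauchy-Schwarz bounds the mixed moment of [u] and [v], and a two-point inequality does the
    rest. *)
Lemma hypercontractivity n F :
  expect p n (fun x => noise p n F x ^+ 4) <= (spectrum p n F).[s] ^+ 2.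
Proof.
elim: n F => [F|n IH F]; first by rewrite /= hornerC -exprM.
set u := noise p n (avg p F); set v := noise p n (jump F).
set a := (spectrum p n (avg p F)).[s]; set b := (spectrum p n (jump F)).[s].
have u4 : expect p n (fun x => u x ^+ 4) <= a ^+ 2 by apply: IH.
have v4 : expect p n (fun x => v x ^+ 4) <= b ^+ 2 by apply: IH.
have a0 : 0 <= a by apply: horner_spectrum_ge0.
have b0 : 0 <= b by apply: horner_spectrum_ge0.
have uv : expect p n (fun x => u x ^+ 2 * v x ^+ 2) <= a * b.
  have ab0 : 0 <= a * b by apply: mulr_ge0.
  rewrite -ler_sqr ?nnegrE //; last first.
    by apply: expect_ge0 => x; rewrite mulr_ge0 ?sqr_ge0.
  apply: le_trans (expect_CauchySchwarz _ _ _) _; rewrite exprMn.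
  have sq4 G : expect p n (fun x => (G x ^+ 2) ^+ 2) = expect p n (fun x => G x ^+ 4).
    by apply: eq_expect => x; rewrite -exprM.
  by rewrite !sq4 ler_pM //; apply: expect_ge0 => x; rewrite exprn_even_ge0.
have -> : (spectrum p n.+1 F).[s] = a + s ^+ 2 * b.
  by rewrite /= hornerD hornerM hornerZ hornerX -/a -/b; ring.
have step : expect p n.+1 (fun x => noise p n.+1 F x ^+ 4) <=
    expect p n (fun x => u x ^+ 4) + 8 * s ^+ 3 * expect p n (fun x => u x ^+ 2 * v x ^+ 2)
    + 3 * s ^+ 5 * expect p n (fun x => v x ^+ 4).
  have -> : expect p n.+1 (fun x => noise p n.+1 F x ^+ 4) = expect p n (fun x =>
      p * (u x + s * (1 - p) * v x) ^+ 4 + (1 - p) * (u x + s * (0 - p) * v x) ^+ 4).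
    by rewrite -expect_avg.
  rewrite -!expectZ -!expectD; apply: expect_le => x.
  set y := u x; set z := v x.
  (* The term in [y * z ^+ 3], from the third central moment of a bit, is absorbed by completing a
     square. *)
  rewrite -subr_ge0 (_ : _ - _ = 2 * s ^+ 3 * (z * (y - s * (1 - 2 * p) * z)) ^+ 2
    + 11 * (s ^+ 3 * z ^+ 2) ^+ 2); last by ring.
  by rewrite addr_ge0 // mulr_ge0 ?sqr_ge0 // mulr_ge0 ?exprn_ge0.
apply: le_trans step _.
(* This turns [8 * s ^+ 3] into [2 * s ^+ 2] and [3 * s ^+ 5] into [s ^+ 4], the coefficients in the
   square of [a + s ^+ 2 * b]. *)
have s4 : 4 * s <= 1 by move: s_le4; move: s => t; lra.
have h1 := ler_wpM2l (exprn_ge0 2 s_ge0) (ler_wpM2l s_ge0 uv).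
have h2 := ler_wpM2l (exprn_ge0 4 s_ge0) (ler_wpM2l s_ge0 v4).
have h3 : s ^+ 2 * (4 * s) * (a * b) <= s ^+ 2 * 1 * (a * b).
  by rewrite ler_wpM2r ?mulr_ge0 // ler_wpM2l ?sqr_ge0.
have h4 : s ^+ 4 * (4 * s) * b ^+ 2 <= s ^+ 4 * 1 * b ^+ 2.
  by rewrite ler_wpM2r ?sqr_ge0 // ler_wpM2l ?exprn_ge0.
have h5 : 0 <= s ^+ 4 * s * b ^+ 2 by rewrite mulr_ge0 ?sqr_ge0 // mulr_ge0 ?exprn_ge0.
move: s u4 h1 h2 h3 h4 h5 => t.
move: (expect p n _) (expect p n _) (expect p n _) => x y z; lra.
Qed.

(** Hölder with exponents 4/3 and 4, carried out as two Cauchy-Schwarz steps, bounds [X] by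
    [J ^ (3/4)] times the 4-norm of [h], which is at most [X ^ (1/2)]. *)
Lemma spectrum_indicator_le n F : (forall x, F x ^+ 2 = F x) ->
  (spectrum p n F).[s] ^+ 2 <= expect p n F ^+ 3.
Proof.
move=> F01; have F0 x : 0 <= F x by rewrite -F01 sqr_ge0.
set X := (spectrum p n F).[s]; set J := expect p n F.
have X0 : 0 <= X by apply: horner_spectrum_ge0.
have J0 : 0 <= J by apply: expect_ge0.
pose h := noise p n F.
have XE : X = expect p n (fun x => F x * (F x * h x)).
  by rewrite /X -expect_mul_noise; apply: eq_expect => x; rewrite mulrA -expr2 F01.
have EF2 : expect p n (fun x => F x ^+ 2) = J by apply: eq_expect.
have c1 : X ^+ 2 <= J * expect p n (fun x => F x * h x ^+ 2).
  rewrite XE; apply: le_trans (expect_CauchySchwarz _ _ _) _; rewrite EF2.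
  have -> // : (fun x => (F x * h x) ^+ 2) = (fun x => F x * h x ^+ 2).
  by apply/funext => x; rewrite exprMn F01.
have c2 : expect p n (fun x => F x * h x ^+ 2) ^+ 2 <= J * X ^+ 2.
  apply: le_trans (expect_CauchySchwarz _ _ _) _; rewrite EF2 ler_wpM2l //.
  have -> : (fun x => (h x ^+ 2) ^+ 2) = (fun x => h x ^+ 4).
    by apply/funext => x; rewrite -exprM.
  exact: hypercontractivity.
set m := expect p n _ in c1 c2.
have m0 : 0 <= m by apply: expect_ge0 => x; rewrite mulr_ge0 ?sqr_ge0.
have X4 : X ^+ 2 * X ^+ 2 <= J ^+ 3 * X ^+ 2.
  have : (X ^+ 2) ^+ 2 <= (J * m) ^+ 2 by rewrite ler_sqr ?nnegrE ?mulr_ge0 ?sqr_ge0.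
  rewrite [X ^+ 2 * _]mulrC -expr2 => /le_trans; apply.
  rewrite exprMn; apply: le_trans (ler_wpM2l (sqr_ge0 J) c2) _.
  by rewrite le_eqVlt; apply/orP; left; apply/eqP; ring.
have [->|Xn] := eqVneq X 0; first by rewrite expr0n exprn_ge0.
by move: X4; rewrite ler_pM2r // exprn_gt0 // lt0r Xn.
Qed.

End Hypercontractivity.

(** * From small influences to a large total influence *)

Section Influences.
Context {R : realType}.
Implicit Types (p : R) (F : seq bool -> R).

(** Markov's inequality: the coefficients of degree above [k + 1] have total at most
    [w'(1) / (k + 1)]; each of degree 1 to [k + 1] enters [w'(s)] with a factor at least [s ^ k]. *)
Lemma deriv_horner_ge (w : {poly R}) (s : R) (k : nat) :
  (forall i, 0 <= w`_i) -> 0 <= s <= 1 ->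
  s ^+ k * (w.[1] - w`_0 - w^`().[1] / k.+1%:R) <= w^`().[s].
Proof.
move=> w0 /andP[s0 s1].
have szw : (size w^`() <= size w)%N.
  by have [->|/lt_size_deriv/ltnW //] := eqVneq w 0; rewrite deriv0.
have E1 : w.[1] - w`_0 = \sum_(i < size w) w`_i.+1.
  rewrite (@horner_coef_wide _ (size w).+1) // big_ord_recl expr0 mulr1 addrC addKr.
  by apply: eq_bigr => i _; rewrite expr1n mulr1.
rewrite E1 !(horner_coef_wide _ szw) mulr_suml -sumrB mulr_sumr.
apply: ler_sum => i _; rewrite coef_deriv expr1n mulr1.
set c := w`_i.+1; have c0 : 0 <= c by apply: w0.
rewrite -[c *+ _]mulr_natr; have k0 : 0 < k.+1%:R :> R by rewrite ltr0Sn.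
have [ik|ki] := leqP i k.
  apply: (@le_trans _ _ (s ^+ k * c)).
    rewrite ler_wpM2l ?exprn_ge0 // gerBl.
    by rewrite divr_ge0 ?mulr_ge0.
  rewrite mulrC; apply: ler_pM; rewrite ?exprn_ge0 //.
    by rewrite ler_peMr // ler1n.
  exact: ler_wiXn2l.
apply: (@le_trans _ _ 0); last by rewrite !mulr_ge0 ?exprn_ge0.
rewrite mulr_ge0_le0 ?exprn_ge0 // subr_le0 ler_pdivlMr // ler_wpM2l // ler_nat.
by rewrite ltnW.
Qed.

Lemma div6_expr6_le n : (n%:R / 6) ^+ 6 <= 2 ^+ n :> R.
Proof.
have n6 : (n <= 6 * 2 ^ (n %/ 6))%N.
  rewrite (leq_trans (ltnW (ltn_ceil n (isT : 0 < 6)%N))) // mulnC leq_mul2l.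
  exact: ltn_expl.
have h : n%:R / 6 <= 2 ^+ (n %/ 6) :> R.
  by rewrite ler_pdivrMr // -natrX -natrM mulnC ler_nat.
apply: (@le_trans _ _ ((2 ^+ (n %/ 6)) ^+ 6)).
  by apply: lerXn2r; rewrite ?nnegrE ?divr_ge0 ?exprn_ge0.
by rewrite -exprM ler_weXn2l ?ler1n // leq_divM.
Qed.

(* Testing the hypothesis at k ~ 2 s I / V costs only a factor s ^+ k >= 2 ^- (n/4),
   because (1/s) ^ s is bounded: no loss occurs as s tends to 0. *)
Lemma influence_numerics (s V I : R) n :
  0 < s -> s <= 4^-1 -> 0 < V -> V <= 4^-1 -> 0 <= I ->
  (forall k, 2 * (s * I) <= k.+1%:R * V ->
     s ^+ k * (V / 2) <= s * (I * Num.sqrt (I / 2 ^+ n))) ->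
  n%:R / 16 * V <= I.
Proof.
move=> s0 s4 V0 V4 I0 spectral_k; rewrite leNgt; apply/negP => ltI.
have sge0 := ltW s0; have Vge0 := ltW V0.
pose x := 2 * s * I / V.
have x0 : 0 <= x by rewrite /x divr_ge0 // mulr_ge0 // mulr_ge0.
pose k := Num.truncn x.
have /andP[kx xk] : k%:R <= x < k.+1%:R by apply: truncn_itv.
have spectral : s ^+ k * (V / 2) <= s * (I * Num.sqrt (I / 2 ^+ n)).
  by apply: spectral_k; rewrite mulrA -ler_pdivrMr // ltW.
have B0 : 0 < 2 ^+ n :> R by rewrite exprn_gt0.
have Bge0 := ltW B0.
have sq : s ^+ (2 * k) * (V ^+ 2 / 4) <= s ^+ 2 * I ^+ 3 / 2 ^+ n.
  have := lerXn2r 2 _ _ spectral; rewrite !nnegrE => /(_ _ _)/le_trans.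
  rewrite !exprMn sqr_sqrtr ?divr_ge0 ?(ltW B0) // -exprM [(k * 2)%N]mulnC => h.
  have -> : V ^+ 2 / 4 = V ^+ 2 * 2^-1 ^+ 2 by field.
  have -> : s ^+ 2 * I ^+ 3 / 2 ^+ n = s ^+ 2 * (I ^+ 2 * (I / 2 ^+ n)) by ring.
  by apply: h; rewrite ?mulr_ge0 ?exprn_ge0 ?sqrtr_ge0 ?invr_ge0.
(* Since [M > 1 / s], one has [s * 2 ^ M >= 1]. The negated goal gives
   [4 * k * M <= 16 * I / V <= n], which is the origin of the constant 16. *)
pose M := (Num.truncn s^-1).+1.
have si0 : 0 <= s^-1 by rewrite invr_ge0.
have /andP[Ms sM] : (Num.truncn s^-1)%:R <= s^-1 < M%:R by apply: truncn_itv.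
have Mk : (M * (4 * k) <= n)%N.
  rewrite -(ler_nat R) !natrM.
  have M2 : M%:R <= 2 / s.
    have s1 : 1 <= s^-1 by rewrite invf_ge1 //; lra.
    by rewrite /M -[(_).+1%:R]natr1 mulrDl mul1r lerD.
  apply: (@le_trans _ _ (2 / s * (4 * x))).
    by rewrite ler_pM ?mulr_ge0 // ler_wpM2l.
  have -> : 2 / s * (4 * x) = 16 * I / V.
    by rewrite /x; field; rewrite !gt_eqF.
  rewrite ler_pdivrMr //; lra.
have one : 1 <= s ^+ (4 * k) * 2 ^+ n.
  have : 1 <= s * 2 ^+ M.
    rewrite mulrC -ler_pdivrMr // mul1r (le_trans (ltW sM)) // -natrX ler_nat.
    exact/ltnW/ltn_expl.
  move/(exprn_ege1 (4 * k)); rewrite exprMn -exprM => /le_trans; apply.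
  by rewrite ler_wpM2l ?exprn_ge0 // ler_weXn2l ?ler1n.
have I6 : I ^+ 6 <= V ^+ 6 * 2 ^+ n.
  apply: (@le_trans _ _ ((n%:R / 6 * V) ^+ 6)).
    have In : I <= n%:R / 6 * V.
      apply: le_trans (ltW ltI) _; rewrite ler_wpM2r // ler_wpM2l //.
      by rewrite lef_pV2 ?posrE ?ler_nat.
    by apply: lerXn2r; rewrite ?nnegrE // (le_trans I0).
  by rewrite exprMn mulrC ler_wpM2l ?exprn_ge0 // div6_expr6_le.
have s41 : s ^+ 4 <= 4^-1.
  have s1 : s <= 1 by lra.
  apply: (le_trans _ s4).
  by rewrite -[leRHS]expr1 ler_wiXn2l.
have sq2 : s ^+ (4 * k) * (V ^+ 4 / 16) <= s ^+ 4 * I ^+ 6 / 2 ^+ n / 2 ^+ n.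
  have a0 : 0 <= s ^+ (2 * k) * (V ^+ 2 / 4) by rewrite mulr_ge0 ?divr_ge0 ?exprn_ge0.
  have := ler_pM a0 a0 sq sq.
  have -> : s ^+ (4 * k) = s ^+ (2 * k) * s ^+ (2 * k) by rewrite -exprD -mulnDl.
  move: (s ^+ (2 * k)) => y.
  have -> : y * (V ^+ 2 / 4) * (y * (V ^+ 2 / 4)) = y * y * (V ^+ 4 / 16) by field.
  by move/le_trans; apply; rewrite le_eqVlt; apply/orP; left; apply/eqP; ring.
(* Chaining [one], [sq2], [s41] and [I6]; this contradicts [0 < V <= 1/4]. *)
have big : V ^+ 4 / 16 <= 4^-1 * V ^+ 6.
  have h1 : V ^+ 4 / 16 <= s ^+ (4 * k) * 2 ^+ n * (V ^+ 4 / 16).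
    by rewrite ler_peMl // divr_ge0 ?exprn_ge0.
  apply: le_trans h1 _; rewrite mulrAC -ler_pdivlMr //.
  apply: le_trans sq2 _; rewrite ler_pM2r ?invr_gt0 // ler_pdivrMr // -[leRHS]mulrA.
  by apply: ler_pM; rewrite ?exprn_ge0.
have V2 : V ^+ 2 <= 4^-1 ^+ 2 by apply: lerXn2r; rewrite ?nnegrE ?invr_ge0.
have V40 : 0 < V ^+ 4 by rewrite exprn_gt0.
have := ler_wpM2l (ltW V40) V2; rewrite -exprD.
by move: V40 big; move: (V ^+ 4) (V ^+ (4 + 2)) => v w; lra.
Qed.

(** [V] is the variance of [F]. The derivative of the spectrum at [s] is at most [s] times the sum
    of the influences to the power 3/2, and at least [s ^ k * V / 2] once
    [k + 1 >= 2 * s * I / V]. *)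
Lemma influence_sum_ge p n N F (I := \sum_(i < N) expect p N (diff i F))
    (V := expect p N F * (1 - expect p N F)) :
  0 < p < 1 -> (forall x, F x ^+ 2 = F x) ->
  (forall i x, diff i F x ^+ 2 = diff i F x) ->
  (forall i : 'I_N, 2 ^+ n * expect p N (diff i F) <= I) ->
  n%:R / 16 * V <= I.
Proof.
move=> /andP[p0 p1] F01 diffF01 inflI.
have p01 : 0 <= p <= 1 by rewrite !ltW.
set s := p * (1 - p).
have s0 : 0 < s by rewrite mulr_gt0 // subr_gt0.
have s4 : s <= 4^-1 by rewrite /s; have := sqr_ge0 (p - 2^-1); lra.
have J0 i : 0 <= expect p N (diff i F).
  by apply: expect_ge0 => // x; rewrite -diffF01 sqr_ge0.
have I0 : 0 <= I by apply: sumr_ge0 => i _.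
have V4 : V <= 4^-1.
  by rewrite /V; have := sqr_ge0 (expect p N F - 2^-1); lra.
have [V0|V0] := leP V 0.
  by apply: le_trans I0; rewrite mulr_ge0_le0 // divr_ge0.
have sge0 := ltW s0.
apply: (@influence_numerics s) => // k kV.
have WI : (spectrum p N F)^`().[1] = s * I.
  rewrite deriv_spectrum hornerZ horner_sum; congr (_ * _); apply: eq_bigr => i _.
  by rewrite spectrum1; apply: eq_expect.
apply: (@le_trans _ _ (spectrum p N F)^`().[s]).
  have s01 : 0 <= s <= 1 by rewrite sge0; lra.
  apply: le_trans (deriv_horner_ge _ s k (coef_spectrum_ge0 _ p01 N F) s01).
  rewrite ler_wpM2l ?exprn_ge0 // WI spectrum1 coef0_spectrum (eq_expect _ _ _ _ F01).
  rewrite (_ : _ - _ ^+ 2 = V); last by rewrite /V; ring.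
  suff : s * I / k.+1%:R <= V / 2 by move: (s * I / _) => y; lra.
  rewrite ler_pdivrMr ?ltr0Sn //.
  by move: kV; move: (s * I) (V) (k.+1%:R) => y v t; lra.
rewrite deriv_spectrum hornerZ ler_wpM2l // horner_sum mulr_suml ler_sum // => i _.
rewrite -ler_sqr ?nnegrE ?mulr_ge0 ?sqrtr_ge0 ?horner_spectrum_ge0 //.
apply: le_trans (spectrum_indicator_le p p01 _ _ (diffF01 i)) _.
rewrite exprMn sqr_sqrtr ?divr_ge0 ?exprn_ge0 // exprSr ler_wpM2l ?exprn_ge0 //.
by rewrite ler_pdivlMr ?exprn_gt0 // mulrC.
Qed.

End Influences.

(** * Winner assignments as bit lists *)

Section Transfer.
Context {R : realType} {T : finType}.
Implicit Types (p : R) (w : {ffun T -> bool}) (G : {ffun T -> bool} -> R).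

Definition assignment (l : seq bool) : {ffun T -> bool} :=
  [ffun o => nth false l (enum_rank o)].

Definition upd w (o : T) (b : bool) : {ffun T -> bool} :=
  [ffun o' => if o' == o then b else w o'].

Lemma assignment_set_nth l o b :
  assignment (set_nth false l (enum_rank o) b) = upd (assignment l) o b.
Proof.
apply/ffunP => o'; rewrite !ffunE nth_set_nth /=.
by rewrite -(inj_eq enum_rank_inj).
Qed.

Lemma expect_tuple p n (F : seq bool -> R) :
  expect p n F = \sum_(t : n.-tuple bool) (\prod_(b <- t) (if b then p else 1 - p)) * F t.
Proof.
elim: n F => [|n IH] F.
  rewrite (big_pred1 [tuple]) => [|t]; first by rewrite big_nil mul1r.
  exact/esym/eqP/tuple0.
rewrite /= !IH (reindex (fun bt : bool * n.-tuple bool => [tuple of bt.1 :: bt.2])) /=; last first.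
  exists (fun t => (thead t, [tuple of behead t])) => [[b t] _|t _] /=.
    by congr pair; apply/val_inj.
  by rewrite -tuple_eta.
rewrite -(pair_bigA _ (fun b (t : n.-tuple bool) =>
  (\prod_(c <- b :: t) (if c then p else 1 - p)) * F (b :: t))) /=.
rewrite big_bool; congr (_ + _); rewrite mulr_sumr; apply: eq_bigr => t _;
  by rewrite big_cons mulrA.
Qed.

Definition weight p w : R := \prod_o (if w o then p else 1 - p).

Lemma expect_assignment p G :
  expect p #|T| (fun l => G (assignment l)) = \sum_w weight p w * G w.
Proof.
rewrite expect_tuple (reindex (fun w => [tuple of codom w])) /=; last first.
  exists (fun t : #|T|.-tuple bool => assignment t) => [w _|t _].
    apply/ffunP => o; rewrite ffunE.
    by rewrite -[in RHS](enum_rankK o) -(nth_codom false).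
  apply/val_inj/(@eq_from_nth _ false) => [|i]; first by rewrite !size_tuple.
  rewrite /= size_codom => iT; rewrite -[i]/(nat_of_ord (Ordinal iT)) nth_codom ffunE.
  by rewrite enum_valK.
apply: eq_bigr => w _; congr (_ * G _).
  by rewrite /codom/image_mem big_map big_enum.
apply/ffunP => o; rewrite ffunE.
by rewrite nth_codom enum_rankK.
Qed.

Definition influence p G o : R := \sum_w weight p w * (G (upd w o true) - G (upd w o false)).

Lemma expect_diff p G o :
  expect p #|T| (diff (enum_rank o) (fun l => G (assignment l))) = influence p G o.
Proof.
rewrite -[RHS](expect_assignment p (fun w => G (upd w o true) - G (upd w o false))).
apply: eq_expect => l.
by rewrite /diff !assignment_set_nth.
Qed.

(** All outcomes have the same bias, so the product weight is invariant under relabelling them along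
    [h]. *)
Lemma influence_perm p G (h : T -> T) o : bijective h ->
  (forall w, G [ffun o => w (h o)] = G w) -> influence p G (h o) = influence p G o.
Proof.
move=> hb Gh; have hi := bij_inj hb; case: (hb) => h' hK h'K.
rewrite /influence [RHS](reindex (fun w => [ffun o => w (h o)])) /=; last first.
  by exists (fun w => [ffun o => w (h' o)]) => w _; apply/ffunP => x; rewrite !ffunE ?hK ?h'K.
apply: eq_bigr => w _; congr (_ * (_ - _)).
- rewrite /weight (reindex h) /=; last exact: onW_bij.
  by apply: eq_bigr => x _; rewrite ffunE.
- by rewrite -Gh; congr G; apply/ffunP => x; rewrite !ffunE (inj_eq hi).
- by rewrite -Gh; congr G; apply/ffunP => x; rewrite !ffunE (inj_eq hi).
Qed.

End Transfer.

(** * Symmetry of the games under flipping recorded moves *)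

Section Game.
Variables (g : game) (n : nat).
Implicit Types (w : {ffun outcome_t n -> bool}) (c a b : {ffun 'I_n -> bool}).

Definition flip c (o : outcome_t n) : outcome_t n := ([ffun i => o.1 i (+) c i], o.2).

Definition flip_hist (m : nat -> bool) (h : seq bool) :=
  mkseq (fun i => nth false h i (+) m i) (size h).

Lemma flip_hist_rcons m h x : flip_hist m (rcons h x) = rcons (flip_hist m h) (x (+) m (size h)).
Proof.
rewrite /flip_hist size_rcons mkseqS nth_rcons ltnn eqxx; congr rcons.
apply/eq_in_map => i; rewrite mem_iota add0n => /andP[_ ih].
by rewrite nth_rcons ih.
Qed.

(** The conjugate strategy unmasks the history, consults [s] and masks the answer. Alice's moves sit
    at every second position from [size h] on. *)
Lemma play_flip (m : nat -> bool) (s : strategy) (l h : seq bool) :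
  flip_hist m (play (fun h => s (flip_hist m h) (+) m (size h)) l h) =
  play s [seq nth false l i (+) m (size h + i.*2)%N | i <- iota 0 (size l)] (flip_hist m h).
Proof.
elim: l h => //= a l IH h; rewrite IH !flip_hist_rcons !size_rcons addn0 addbK.
congr play; rewrite -[1%N]addn0 iotaDl -map_comp; apply: eq_map => i /=.
by rewrite doubleS !addSn !addnS.
Qed.

Lemma size_play s l h : size (play s l h) = (size h + (size l).*2)%N.
Proof. by elim: l h => [|a l IH] h /=; rewrite ?addn0 // IH !size_rcons; lia. Qed.

(** [s'] simulates [s] in a game where the moves of the recorded player are flipped by [c]; the
    counted player moves identically in both games. *)
Lemma bob_moves_flip c (s : strategy) : exists s' : strategy, forall a,
  flip c (outcome g a (bob_moves s' a)) =
  outcome g (if g is Ab then [ffun i => a i (+) c i] else a)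
            (bob_moves s (if g is Ab then [ffun i => a i (+) c i] else a)).
Proof.
pose cn i := nth false [seq c j | j <- enum 'I_n] i.
have nthE (x : {ffun 'I_n -> bool}) (i : 'I_n) : nth false [seq x j | j <- enum 'I_n] i = x i.
  by rewrite (nth_map i) ?size_enum_ord // nth_ord_enum.
(* Positions [2 * i] and [2 * i + 1] hold Alice's and Bob's moves of round [i]. *)
pose m k := (if g is Ab then ~~ odd k else odd k) && cn k./2.
exists (fun h => s (flip_hist m h) (+) m (size h)) => a.
set s' := (fun h => _).
set a' := if g is Ab then _ else _.
have sb i : nth false (play s [seq a' j | j <- enum 'I_n] [::]) (i : 'I_n).*2.+1 =
   nth false (play s' [seq a j | j <- enum 'I_n] [::]) i.*2.+1 (+) m i.*2.+1.
  have sz : (i.*2.+1 < size (play s' [seq a j | j <- enum 'I_n] [::]))%N.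
    by rewrite size_play size_map size_enum_ord /=; have := ltn_ord i; lia.
  rewrite -[RHS](@nth_mkseq _ false (fun i => nth false _ i (+) m i) _ _ sz).
  rewrite -/(flip_hist m _) play_flip; congr (nth _ (play _ _ _) _).
  have sza (x : {ffun 'I_n -> bool}) : size [seq x j | j <- enum 'I_n] = n.
    by rewrite size_map size_enum_ord.
  rewrite sza; apply: (@eq_from_nth _ false) => [|k].
    by rewrite sza size_map size_iota.
  rewrite sza => kn; rewrite (nth_map 0%N) ?size_iota // nth_iota // !add0n.
  rewrite -[k]/(nat_of_ord (Ordinal kn)) !nthE /m /a' odd_double doubleK /cn nthE.
  by case: (g) => /=; rewrite ?ffunE ?addbF.
have bE : bob_moves s a' = if g is Ab then bob_moves s' a else [ffun i => bob_moves s' a i (+) c i].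
  apply/ffunP => i; rewrite ffunE sb /m /= odd_double /= uphalf_double /cn nthE.
  by case: (g) => /=; rewrite ?ffunE ?addbF.
by rewrite bE /a' /flip; case: (g).
Qed.

End Game.

Section GameSymmetry.
Variables (g : game) (n : nat).
Implicit Types (w : {ffun outcome_t n -> bool}) (c : {ffun 'I_n -> bool}).

Lemma flipK c : involutive (flip n c).
Proof. by case=> x k; congr pair; apply/ffunP => i; rewrite !ffunE addbK. Qed.

Lemma bob_wins_mono w w' : (forall o, w o ==> w' o) -> bob_wins g w -> bob_wins g w'.
Proof.
move=> ww' [s sw]; exists s => a.
by have /implyP := ww' (outcome g a (bob_moves s a)); apply.
Qed.

Lemma bob_wins_flip c w : bob_wins g w -> bob_wins g [ffun o => w (flip n c o)].
Proof.
by case=> s sw; have [s' s'E] := bob_moves_flip g n c s; exists s' => a; rewrite ffunE s'E.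
Qed.

Lemma bob_wins_flipE c w :
  `[< bob_wins g [ffun o => w (flip n c o)] >] = `[< bob_wins g w >].
Proof.
apply/asboolP/asboolP => [/(bob_wins_flip c)|]; last exact: bob_wins_flip.
by congr bob_wins; apply/ffunP => o; rewrite !ffunE flipK.
Qed.

End GameSymmetry.

(** * The differential inequality for the winning probability *)

Section Sharpness.
Context {R : realType}.
Variables (g : game) (n : nat).
Implicit Types (p : R) (w : {ffun outcome_t n -> bool}).

Local Notation N := #|{: outcome_t n}|.

Definition bob_indicator w : R := (`[< bob_wins g w >])%:R.

Definition win (l : seq bool) : R := bob_indicator (assignment l).

Lemma Pn_expect p : Pn g n p = expect p N win.
Proof.
rewrite /win (expect_assignment p bob_indicator) /Pn big_mkcond.
by apply: eq_bigr => w _; rewrite /bob_indicator; case: asboolP => _; rewrite ?mulr1 ?mulr0.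
Qed.

(** Giving Bob one more outcome cannot hurt him, so the value -1 is excluded. *)
Lemma diff_win01 i l : diff i win l ^+ 2 = diff i win l.
Proof.
rewrite /diff /win /bob_indicator.
have := @bob_wins_mono g n (assignment (set_nth false l i false))
  (assignment (set_nth false l i true)).
case: asboolP => h1; case: asboolP => h0 mono;
  rewrite ?subrr ?subr0 ?expr0n ?expr1n //.
case: h1; apply: mono => // o.
by rewrite !ffunE !nth_set_nth /=; case: eqP => // _; apply/implyP.
Qed.

Lemma influence_win_flip p x y k :
  influence p bob_indicator (x, k) = influence p bob_indicator (y, k).
Proof.
(* The flip by this [c] carries [y] to [x]: flips act transitively on move vectors. *)
pose c := [ffun i => x i (+) y i].
have -> : (x, k) = flip n c (y, k).
  by congr pair; apply/ffunP => i; rewrite !ffunE /=; case: (x i); case: (y i).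
apply: influence_perm; first exact: inv_bij (flipK _ _).
by move=> w; rewrite /bob_indicator bob_wins_flipE.
Qed.

(* All outcomes sharing the count component have the same influence. *)
Lemma influence_win_le p (i : 'I_N) : 0 <= p <= 1 ->
  2 ^+ n * expect p N (diff i win) <= \sum_(j < N) expect p N (diff j win).
Proof.
move=> p01; pose J o := influence p bob_indicator o.
have JE o : expect p N (diff (enum_rank o) win) = J o by apply: expect_diff.
have J0 o : 0 <= J o.
  by rewrite -JE; apply: expect_ge0 => // l; rewrite -diff_win01 sqr_ge0.
rewrite (reindex (@enum_rank (outcome_t n))) /=; last first.
  by apply: onW_bij; exists enum_val; [exact: enum_rankK|exact: enum_valK].
under eq_bigr do rewrite JE.
rewrite -[i]enum_valK JE; case: (enum_val i) => x k.
rewrite -(pair_bigA _ (fun y k => J (y, k))) /= exchange_big (bigD1 k) //=.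
rewrite (eq_bigr (fun=> J (x, k))) => [|y _]; last exact: influence_win_flip.
rewrite sumr_const card_ffun card_bool card_ord -natrX mulr_natl lerDl.
by apply: sumr_ge0 => ? _; apply: sumr_ge0.
Qed.

Definition win_poly : {poly R} := expect 'X N (fun l => (win l)%:P).

Lemma horner_win_poly p : win_poly.[p] = Pn g n p.
Proof. by rewrite horner_expectX Pn_expect. Qed.

Lemma horner_deriv_win_poly p : win_poly^`().[p] = \sum_(i < N) expect p N (diff i win).
Proof.
by rewrite deriv_expectX horner_sum; apply: eq_bigr => i _; rewrite horner_expectX.
Qed.

Lemma deriv_win_poly_ge p : 0 < p < 1 ->
  n%:R / 16 * (Pn g n p * (1 - Pn g n p)) <= win_poly^`().[p].
Proof.
move=> p01; rewrite horner_deriv_win_poly Pn_expect.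
apply: influence_sum_ge => // [l|i l|i].
- by rewrite /win /bob_indicator; case: asboolP; rewrite ?expr1n ?expr0n.
- exact: diff_win01.
- by apply: influence_win_le; case/andP: p01 => *; rewrite !ltW.
Qed.

Lemma deriv_win_poly_ge0 p : 0 <= p <= 1 -> 0 <= win_poly^`().[p].
Proof.
move=> p01; rewrite horner_deriv_win_poly; apply: sumr_ge0 => i _.
by apply: expect_ge0 => // l; rewrite -diff_win01 sqr_ge0.
Qed.

End Sharpness.

(** * The width of the threshold window, by the mean value theorem *)

Theorem theorem14 (R : realType) (g : game) (eps : R) :
  0 < eps -> eps <= 2^-1 ->
  exists C : R, forall n : nat, (0 < n)%N ->
    forall p q : R, 0 <= p <= 1 -> 0 <= q <= 1 ->
      @Pn R g n p = eps -> @Pn R g n q = 1 - eps ->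
      q - p <= C / n%:R.
Proof.
(* The slope between [p] and [q] will be at least [(n / 16) * (eps / 2)]. *)
move=> eps0 eps2; exists (32 / eps) => n n0 p q /andP[p0 p1] /andP[q0 q1] Pp Pq.
have nR : 0 < n%:R :> R by rewrite ltr0n.
have [qp|pq] := leP q p.
  by apply: (@le_trans _ _ 0); rewrite ?subr_le0 // !divr_ge0 ?ltW.
have [c /[!in_itv]/= /andP[pc cq] mvtE] := poly_mvt (win_poly g n) pq.
have mono : {in `[p, q] &, {homo horner (win_poly g n) : x y / x <= y}}.
  apply: ler_hornerW => x; rewrite in_itv /= => /andP[px xq].
  by apply: deriv_win_poly_ge0; rewrite ltW ?ltW //; lra.
have c01 : 0 < c < 1 by rewrite (le_lt_trans p0) // (lt_le_trans cq).
have cpq : c \in `[p, q] by rewrite in_itv /= !ltW.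
have ge_eps : eps <= Pn g n c.
  by rewrite -Pp -!horner_win_poly mono ?in_itv /= ?lexx ?ltW.
have le_eps : Pn g n c <= 1 - eps.
  by rewrite -Pq -!horner_win_poly mono ?in_itv /= ?lexx ?ltW.
(* On this range the product is at least [eps * (1 - eps)], and [1 - eps >= 1/2]. *)
have V : eps / 2 <= Pn g n c * (1 - Pn g n c).
  by nra.
move: mvtE; rewrite !horner_win_poly Pp Pq => mvtE.
have slope : n%:R / 16 * (eps / 2) <= (win_poly g n)^`().[c].
  by apply: le_trans (deriv_win_poly_ge g n c c01); rewrite ler_wpM2l ?divr_ge0.
have qp0 : 0 <= q - p by rewrite subr_ge0 ltW.
have := ler_wpM2r qp0 slope; rewrite -mvtE => h.
rewrite ler_pdivlMr // ler_pdivlMr //.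
by lra.
Qed.
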